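(* The function $p:cabv(X,0)\to\mathbb{R}_+$ given by $$p(\mu)=\|\mu\|_{MK}^{*}=\sup\Big\{\Big|\int f\,d\mu\Big| \;:\; f\in L_1(X)\Big\}$$ is a norm on $cabv(X,0)$ (in particular it takes only finite values).
   Context: $(T,d)$ is a compact metric space with at least two elements, with Borel $\sigma$-algebra $\mathcal{B}$. $X$ is a nonzero Hilbert space over $K$ ($K=\mathbb{R}$ or $K=\mathbb{C}$), with scalar product $(\cdot\mid\cdot)$ (linear in the first variable, conjugate-linear in the second) and norm $\|\cdot\|$. $C(X)$ is the space of continuous functions $f:T\to X$ with the sup norm $\|f\|$. $cabv(X)$ is the vector space over $K$ of $\sigma$-additive measures $\mu:\mathcal{B}\to X$ of bounded variation, where the variation is $|\mu|(A)=\sup\sum_i\|\mu(A_i)\|$ over finite partitions $(A_i)$ of $A$ into Borel sets; $\|\mu\|=|\mu|(T)$. $cabv(X,0)=\{\mu\in cabv(X):\mu(T)=0\}$, a vector subspace. Integral: for a simple function $f=\sum_{i=1}^m\varphi_{A_i}x_i$ ($A_i\in\mathcal{B}$, $x_i\in X$, $\varphi_{A}$ the indicator function of $A$) put $\int f\,d\mu=\sum_{i=1}^m(x_i\mid\mu(A_i))\in K$; for $f\in C(X)$ put $\int f\,d\mu=\lim_n\int f_n\,d\mu$, where $(f_n)$ is any sequence of simple functions converging uniformly to $f$ (the limit exists and does not depend on the sequence; the integral is linear in $f$, conjugate-linear in $\mu$, and $|\int f\,d\mu|\le\|\mu\|\|f\|$). $L(X)$ is the space of Lipschitz functions $f:T\to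 X$, $\|f\|_L$ is the least Lipschitz constant of $f$, and $L_1(X)=\{f\in L(X):\|f\|_L\le1\}$. $\mathbb{R}_+=[0,\infty)$. *)

(* Defs.v *)
From HB Require Import structures.
From mathcomp Require Import all_boot all_order all_algebra.
From mathcomp Require Import complex sesquilinear.
From mathcomp Require Import all_classical all_reals all_analysis.

Set Implicit Arguments.
Unset Strict Implicit.
Unset Printing Implicit Defensive.

Import Order.TTheory GRing.Theory Num.Theory.
Import numFieldNormedType.Exports.

Local Open Scope classical_set_scope.
Local Open Scope ring_scope.

Variant scalar_kind := RealScalars | ComplexScalars.

Definition scalar_field (R : realType) (k : scalar_kind) : numFieldType :=
  match k with
  | RealScalars => R
  | ComplexScalars => R[i]
  end.

Definition scalar_conj (R : realType) (k : scalar_kind) :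
    {rmorphism scalar_field R k -> scalar_field R k} :=
  match k return {rmorphism scalar_field R k -> scalar_field R k} with
  | RealScalars => idfun
  | ComplexScalars => @conjc R
  end.

Definition scalar_Re (R : realType) (k : scalar_kind) : scalar_field R k -> R :=
  match k return scalar_field R k -> R with
  | RealScalars => id
  | ComplexScalars => @complex.Re R
  end.

(* MathComp norms take their values in the scalar field; over the complex
   numbers [`|v|] is a complex number with zero imaginary part. *)
Definition rnorm (R : realType) (k : scalar_kind)
  (V : normedZmodType (scalar_field R k)) (v : V) : R := scalar_Re `|v|.

(* The scalar product, linear in its first argument and conjugate-linear in the
   second, induces the norm of the Banach space X. *)
Definition hilbert_product (R : realType) (k : scalar_kind)
    (X : completeNormedModType (scalar_field R k))
    (dot : {dot X for scalar_conj R k}) : Prop :=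
  forall x : X, `|x| ^+ 2 = dot x x.

Record is_norm (R : realType) (k : scalar_kind)
    (V : lmodType (scalar_field R k)) (p : V -> R) : Prop := IsNorm {
  is_norm_ge0 : forall v, 0 <= p v ;
  is_norm_eq0 : forall v, p v = 0 <-> v = 0 ;
  is_normZ : forall (a : scalar_field R k) v, p (a *: v) = rnorm a * p v ;
  is_normD : forall v w, p (v + w) <= p v + p w
}.

(* Used as a type, [borel T] is the type of Borel sets, through [set_type]. *)
Definition borel (T : topologicalType) : set (set T) := <<s (@open T) >>.
Arguments borel T : clear implicits.

Lemma borelT_subproof (T : topologicalType) : [set: T] \in borel T.
Proof.
apply/mem_set; rewrite -(setD0 setT).
by case: (smallest_sigma_algebra [set: T] (@open T)) => ? h _; exact: h.
Qed.

Definition borelT (T : topologicalType) : borel T :=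
  exist _ [set: T] (borelT_subproof T).

Section cabv.
Context (R : realType) (k : scalar_kind) (T : metricType R)
  (X : normedModType (scalar_field R k)).

Definition countably_additive (mu : borel T -> X) : Prop :=
  forall (F : nat -> borel T) (A : borel T),
    trivIset [set: nat] (fun i => val (F i)) ->
    val A = \bigcup_i val (F i) ->
    (fun n => \sum_(0 <= i < n) mu (F i)) @ \oo --> mu A.

(* Blocks may be empty: since mu vanishes on the empty set, this does not change
   the variation. *)
Definition borel_partition (A : set T) (n : nat) (P : 'I_n -> borel T) : Prop :=
  trivIset [set: 'I_n] (fun i => val (P i)) /\ \bigcup_i val (P i) = A.

Definition variation (mu : borel T -> X) (A : set T) : \bar R :=
  ereal_sup [set r | exists (n : nat) (P : 'I_n -> borel T),
    borel_partition A P /\ r = (\sum_(i < n) rnorm (mu (P i)))%:E].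

Definition cabv_pred : {pred borel T -> X} := fun mu =>
  `[< countably_additive mu /\ (variation mu [set: T] < +oo)%E >].

End cabv.

Section scalar_lemmas.
Context (R : realType) (k : scalar_kind).

Lemma scalar_ReD (x y : scalar_field R k) :
  scalar_Re (x + y) = scalar_Re x + scalar_Re y.
Proof. by case: k x y => //= -[a b] [c d]. Qed.

Lemma scalar_Re_le (x y : scalar_field R k) :
  x <= y -> scalar_Re x <= scalar_Re y.
Proof. by case: k x y => //= -[a b] [c d]; rewrite lecE => /andP[]. Qed.

Lemma scalar_ReM (x y : scalar_field R k) :
  0 <= x -> scalar_Re (x * y) = scalar_Re x * scalar_Re y.
Proof.
case: k x y => //= -[a b] [c d]; rewrite lecE => /andP[/= /eqP -> _].
by rewrite mul0r subr0.
Qed.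

Lemma rnorm_ge0 (V : normedZmodType (scalar_field R k)) (v : V) : 0 <= rnorm v.
Proof.
have -> : 0 = @scalar_Re R k 0 by case: k.
exact/scalar_Re_le/normr_ge0.
Qed.

Lemma rnormD (V : normedZmodType (scalar_field R k)) (v w : V) :
  rnorm (v + w) <= rnorm v + rnorm w.
Proof. by rewrite -scalar_ReD; exact/scalar_Re_le/ler_normD. Qed.

Lemma rnormZ (V : normedModType (scalar_field R k)) (a : scalar_field R k)
    (v : V) :
  rnorm (a *: v) = rnorm a * rnorm v.
Proof. by rewrite /rnorm normrZ scalar_ReM. Qed.

End scalar_lemmas.

Section cabv_lmod.
Context (R : realType) (k : scalar_kind) (T : metricType R)
  (X : normedModType (scalar_field R k)).

Lemma variation_fin (mu : borel T -> X) (A : set T) :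
  (variation mu A < +oo)%E <->
  exists M : R, forall (n : nat) (P : 'I_n -> borel T),
    borel_partition A P -> \sum_(i < n) rnorm (mu (P i)) <= M.
Proof.
split => [|[M hM]].
  move=> vA; exists (fine (variation mu A)) => n P AP.
  have le_var : ((\sum_(i < n) rnorm (mu (P i)))%:E <= variation mu A)%E.
    by apply: ereal_sup_ubound; exists n, P.
  by move: vA le_var; case: (variation mu A).
apply: le_lt_trans (ltry M).
by apply: ge_ereal_sup => _ [n [P [AP ->]]]; rewrite lee_fin hM.
Qed.

Lemma cabv_submod_closed : submod_closed (@cabv_pred R k T X).
Proof.
split.
  apply/asboolP; split.
    move=> F A _ _.
    under eq_fun do rewrite big1//.
    exact: cvg_cst.
  apply/variation_fin; exists 0 => n P _; rewrite big1// => i _.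
  by rewrite /rnorm normr0; case: k.
move=> a mu nu /asboolP[mua muv] /asboolP[nua nuv]; apply/asboolP; split.
  move=> F A tF AF.
  under eq_fun do rewrite big_split/= -scaler_sumr.
  by apply: cvgD (nua _ _ tF AF); apply: cvgZr; exact: (mua _ _ tF AF).
move/variation_fin : muv => [M hM]; move/variation_fin : nuv => [N hN].
apply/variation_fin; exists (rnorm a * M + N) => n P AP.
apply: (@le_trans _ _ (\sum_(i < n)
    (rnorm a * rnorm (mu (P i)) + rnorm (nu (P i))))).
  by apply: ler_sum => i _; rewrite -rnormZ; exact: rnormD.
rewrite big_split/= -mulr_sumr lerD ?hN// ler_wpM2l ?hM//.
exact: rnorm_ge0.
Qed.

HB.instance Definition _ := GRing.isSubmodClosed.Build (scalar_field R k)
  (borel T -> X) (@cabv_pred R k T X) cabv_submod_closed.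

Record cabv := Cabv {
  cabv_fun :> borel T -> X ;
  _ : cabv_fun \in @cabv_pred R k T X
}.

HB.instance Definition _ := [isSub for cabv_fun].
HB.instance Definition _ := [Choice of cabv by <:].
HB.instance Definition _ := [SubChoice_isSubLmodule of cabv by <:].

Definition cabv0_pred : {pred cabv} := fun mu => mu (borelT T) == 0.

Lemma cabv0_submod_closed : submod_closed cabv0_pred.
Proof.
split; first exact/eqP.
move=> a mu nu /eqP mu0 /eqP nu0; apply/eqP.
change (a *: (mu (borelT T)) + nu (borelT T) = 0).
by rewrite mu0 nu0 scaler0 addr0.
Qed.

HB.instance Definition _ := GRing.isSubmodClosed.Build (scalar_field R k)
  cabv cabv0_pred cabv0_submod_closed.

Record cabv0 := Cabv0 { cabv0_cabv :> cabv ; _ : cabv0_cabv \in cabv0_pred }.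

HB.instance Definition _ := [isSub for cabv0_cabv].
HB.instance Definition _ := [Choice of cabv0 by <:].
HB.instance Definition _ := [SubChoice_isSubLmodule of cabv0 by <:].

End cabv_lmod.

Arguments cabv {R k} T X.
Arguments cabv0 {R k} T X.

Section integral.
Context (R : realType) (k : scalar_kind) (T : metricType R)
  (X : completeNormedModType (scalar_field R k))
  (dot : {dot X for scalar_conj R k}).

(* The list of pairs (A_i, x_i) represents the sum of the phi_(A_i) x_i; the
   A_i need not be disjoint. *)
Definition simple_fun (s : seq (borel T * X)) (t : T) : X :=
  \sum_(q <- s) (\1_(val q.1) t : scalar_field R k) *: q.2.

Definition simple_integral (mu : borel T -> X) (s : seq (borel T * X)) :
    scalar_field R k :=
  \sum_(q <- s) dot q.2 (mu q.1).

Definition is_integral (mu : borel T -> X) (f : T -> X)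
    (l : scalar_field R k) : Prop :=
  exists s : nat -> seq (borel T * X),
    {uniform, (fun n => simple_fun (s n)) @ \oo --> f} /\
    (fun n => simple_integral mu (s n)) @ \oo --> l.

(* For T compact, f continuous and mu in cabv(X), exactly one l satisfies
   [is_integral], and the simple integrals converge to it along every sequence
   of simple functions converging uniformly to f. *)
Definition integral (mu : cabv T X) (f : T -> X) : scalar_field R k :=
  xget 0 (is_integral mu f).

Definition lipschitz_const (f : T -> X) : set R :=
  [set L | 0 <= L /\ forall s t, rnorm (f s - f t) <= L * mdist s t].

Definition lipschitz_norm (f : T -> X) : R := inf (lipschitz_const f).

(* The set L_1(X). *)
Definition lipschitz_ball : set (T -> X) :=
  [set f | lipschitz_const f !=set0 /\ lipschitz_norm f <= 1].

Definition MKnorm (mu : cabv0 T X) : \bar R :=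
  ereal_sup [set (rnorm (integral mu f))%:E | f in lipschitz_ball].

End integral.

(* Main.v *)
(* Refining the sets of a simple function to a partition and using
   Cauchy-Schwarz bounds its integral by sup-norm times variation; hence the
   integral exists and is additive in mu. Finiteness: as mu(T) = 0, a constant
   can be subtracted from f, and f - f(t0) is bounded by the diameter of T.
   Definiteness: if all Lipschitz functions have integral 0, apply this to
   min(d, g) y, with g the distance to the complement of an open set U and
   y a positive multiple of mu(U). Its integral is a limit of averages of
   d (y | mu{g > r}) for 0 <= r <= d, and mu{g > r} tends to mu(U) as r -> 0,
   so (y | mu(U)) = 0 and mu(U) = 0. Open sets form a pi-system, so mu = 0. *)
From HB Require Import structures.
Require Import Defs.
From mathcomp Require Import all_boot all_order all_algebra.
From mathcomp Require Import complex sesquilinear.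
From mathcomp Require Import all_classical all_reals all_analysis.
From mathcomp Require Import ring lra.

Set Implicit Arguments.
Unset Strict Implicit.
Unset Printing Implicit Defensive.

Import Order.TTheory GRing.Theory Num.Theory.
Import numFieldNormedType.Exports.

Local Open Scope classical_set_scope.
Local Open Scope ring_scope.


(** * Real and complex scalars treated uniformly, and the real-valued norm *)

Section scalars.
Context (R : realType) (k : scalar_kind).
Local Notation K := (scalar_field R k).

(** Norms take values in [K] while the estimates are made in [R]; this embedding carries
    inequalities between the two. *)
Definition scalar_real : {rmorphism R -> K} :=
  match k return {rmorphism R -> scalar_field R k} with
  | RealScalars => idfun
  | ComplexScalars => @real_complex R
  end.

Lemma scalar_Re0 : scalar_Re (0 : K) = 0.
Proof. by case: k. Qed.

Lemma ge0_scalar_ReK (z : K) : 0 <= z -> scalar_real (scalar_Re z) = z.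
Proof.
rewrite /scalar_real; case: k z => //= -[a b].
by rewrite lecE => /andP[/= /eqP -> _].
Qed.

Lemma ler_scalar_real (x y : R) : (scalar_real x <= scalar_real y) = (x <= y).
Proof. by rewrite /scalar_real; case: k => //=; rewrite lecR. Qed.

Lemma ltr_scalar_real (x y : R) : (scalar_real x < scalar_real y) = (x < y).
Proof. by rewrite /scalar_real; case: k => //=; rewrite ltcR. Qed.

Lemma scalar_real_gt0P (e : K) :
  0 < e -> exists2 d : R, 0 < d & e = scalar_real d.
Proof.
move=> e0; exists (scalar_Re e); last by rewrite ge0_scalar_ReK// ltW.
by rewrite -ltr_scalar_real rmorph0 ge0_scalar_ReK// ltW.
Qed.

Lemma scalar_conj_real x : scalar_conj R k (scalar_real x) = scalar_real x.
Proof. by rewrite /scalar_conj /scalar_real; case: k => //=; rewrite oppr0. Qed.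

Section rnorm.
Variable V : normedZmodType K.
Implicit Types v w : V.

Lemma normE v : `|v| = scalar_real (rnorm v).
Proof. by rewrite /rnorm ge0_scalar_ReK. Qed.

Lemma rnorm0 : rnorm (0 : V) = 0.
Proof. by rewrite /rnorm normr0 scalar_Re0. Qed.

Lemma rnorm_eq0 v : (rnorm v == 0) = (v == 0).
Proof. by rewrite -[RHS]normr_eq0 normE fmorph_eq0. Qed.

Lemma rnormN v : rnorm (- v) = rnorm v.
Proof. by rewrite /rnorm normrN. Qed.

Lemma rnormBC v w : rnorm (v - w) = rnorm (w - v).
Proof. by rewrite -rnormN opprB. Qed.

Lemma rnorm_distD u v w : rnorm (v - w) <= rnorm (v - u) + rnorm (u - w).
Proof. by apply: le_trans (rnormD _ _); rewrite addrA subrK. Qed.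

Lemma rnorm_sum (I : Type) (r : seq I) (P : pred I) (F : I -> V) :
  rnorm (\sum_(i <- r | P i) F i) <= \sum_(i <- r | P i) rnorm (F i).
Proof.
elim/big_ind2 : _ => //; first by rewrite rnorm0.
by move=> a x b y ax yb; apply: le_trans (rnormD _ _) _; exact: lerD.
Qed.

End rnorm.

Lemma rnormM (a b : K) : rnorm (a * b) = rnorm a * rnorm b.
Proof. by rewrite /rnorm normrM scalar_ReM. Qed.

Lemma rnorm_real x : rnorm (scalar_real x) = `|x|.
Proof.
apply: (fmorph_inj scalar_real); rewrite -normE /scalar_real.
by case: k => //=; rewrite normc_def/= expr0n/= addr0 sqrtr_sqr.
Qed.

Lemma rnorm_conj (a : K) : rnorm (scalar_conj R k a) = rnorm a.
Proof.
apply: (fmorph_inj scalar_real); rewrite -!normE /scalar_conj.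
case: k a => //= -[a b].
by rewrite !normc_def /= sqrrN.
Qed.

Lemma mul_scalar_conj (a : K) :
  a * scalar_conj R k a = scalar_real (rnorm a ^+ 2).
Proof.
rewrite rmorphXn/= -normE /scalar_conj; case: k a => [a|z] /=.
  by rewrite real_normK ?num_real// expr2.
by rewrite sqr_normc mulrC.
Qed.

(** Every positive element of [K] is the image of a positive real, so real tolerances suffice. *)
Lemma rnorm_cvgP (V : normedModType K) (u : nat -> V) (l : V) :
  u @ \oo --> l <->
  (forall e : R, 0 < e -> \forall n \near \oo, rnorm (l - u n) <= e).
Proof.
split=> [/cvgrPdist_le ul e e0|ul].
  have := ul (scalar_real e); rewrite -(rmorph0 scalar_real) ltr_scalar_real.
  by move=> /(_ e0); apply: filterS => n; rewrite normE ler_scalar_real.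
apply/cvgrPdist_le => _ /scalar_real_gt0P[e e0 ->].
by apply: filterS (ul e e0) => n; rewrite normE ler_scalar_real.
Qed.

Lemma rnorm_cvgKP (u : nat -> K) (l : K) :
  u @ \oo --> l <->
  (forall e : R, 0 < e -> \forall n \near \oo, rnorm (l - u n) <= e).
Proof. exact: (@rnorm_cvgP K^o). Qed.

Lemma rnorm_cauchy_cvg (V : completeNormedModType K) (u : nat -> V) :
  (forall e : R, 0 < e ->
    exists N, forall n, (N <= n)%N -> rnorm (u N - u n) <= e) ->
  cvg (u @ \oo).
Proof.
move=> cu; apply/cauchy_cvgP/cauchyP => _ /scalar_real_gt0P[e e0 ->].
have [|N uN] := cu (e / 2); first by rewrite divr_gt0.
exists (u N), N => // n /= Nn; rewrite -ball_normE /= normE ltr_scalar_real.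
by apply: le_lt_trans (uN _ Nn) _; rewrite gtr_pMr// invf_lt1// ltr1n.
Qed.

End scalars.

(** The entourages of [X] are generated by balls of positive radius. In the converse, halving the
    radius turns the weak inequality into membership in an open ball. *)
Lemma uniform_rnormP (R : realType) (k : scalar_kind) (T : choiceType)
    (X : normedModType (scalar_field R k)) (u : nat -> T -> X) (f : T -> X) :
  {uniform, u @ \oo --> f} <->
  (forall e : R, 0 < e ->
    \forall n \near \oo, forall t, rnorm (f t - u n t) <= e).
Proof.
split=> [uf e e0|uf].
apply: (uf [set g | forall t, rnorm (f t - g t) <= e]); apply/uniform_nbhs.
  exists [set xy | ball xy.1 (scalar_real R k e) xy.2]; split.
    have e0' : 0 < scalar_real R k e.
      by rewrite -(rmorph0 (scalar_real R k)) ltr_scalar_real.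
    exact: (entourage_ball X (PosNum e0')).
  move=> h /= hE t; have := hE t Logic.I.
  by rewrite -ball_normE/= normE ltr_scalar_real => /ltW.
move=> P /uniform_nbhs[E [entE EP]].
move: entE; rewrite -entourage_ballE => -[_/= /scalar_real_gt0P[e e0 ->] eE].
have : \forall n \near \oo, forall t, rnorm (f t - u n t) <= e / 2.
  by apply: uf; rewrite divr_gt0.
apply: filterS => n fu; apply: EP => t _; apply: eE.
rewrite /= -ball_normE/= normE ltr_scalar_real.
by apply: le_lt_trans (fu t) _; rewrite gtr_pMr// invf_lt1// ltr1n.
Qed.

Lemma scalar_cvg_unique (R : realType) (k : scalar_kind)
    (u : nat -> scalar_field R k) (a b : scalar_field R k) :
  u @ \oo --> a -> u @ \oo --> b -> a = b.
Proof.
exact: (@cvg_unique (scalar_field R k)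
  (@norm_hausdorff _ (scalar_field R k)^o)).
Qed.


(** * The scalar product and the Cauchy-Schwarz inequality *)

Section dot_product.
Context (R : realType) (k : scalar_kind).
Local Notation K := (scalar_field R k).
Context (X : completeNormedModType K) (dot : {dot X for scalar_conj R k}).
Hypothesis X_hilbert : hilbert_product dot.
Local Notation real := (scalar_real R k).

Lemma dotDl x y z : dot (x + y) z = dot x z + dot y z.
Proof. exact: linearDl. Qed.

Lemma dotDr x y z : dot x (y + z) = dot x y + dot x z.
Proof. exact: linearDr. Qed.

Lemma dot_sumr x (I : Type) (r : seq I) (P : pred I) (F : I -> X) :
  dot x (\sum_(i <- r | P i) F i) = \sum_(i <- r | P i) dot x (F i).
Proof. exact: linear_sumr. Qed.

Lemma dotBl x y z : dot (x - y) z = dot x z - dot y z.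
Proof. exact: linearBl. Qed.

Lemma dotBr x y z : dot x (y - z) = dot x y - dot x z.
Proof. exact: linearBr. Qed.

Lemma dotZl a x y : dot (a *: x) y = a * dot x y.
Proof. exact: linearZl_LR. Qed.

Lemma dotZr a x y : dot x (a *: y) = scalar_conj R k a * dot x y.
Proof. exact: linearZr_LR. Qed.

Lemma dot_conj x y : dot y x = scalar_conj R k (dot x y).
Proof. by rewrite hermC expr0 mul1r. Qed.

Lemma dot_self x : dot x x = real (rnorm x ^+ 2).
Proof. by rewrite -X_hilbert normE rmorphXn. Qed.

Lemma cauchy_schwarz x y : rnorm (dot x y) <= rnorm x * rnorm y.
Proof.
have [->|y0] := eqVneq y 0.
  by rewrite linear0r !rnorm0 mulr0.
set n := rnorm y ^+ 2; set a := dot x y.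
have n0 : 0 < n by rewrite exprn_gt0// lt_neqAle eq_sym rnorm_eq0 y0 rnorm_ge0.
(* This is the component of x orthogonal to y, scaled by the square of the norm of y to avoid a
   division; nonnegativity of (z | z) is the inequality. *)
pose z := real n *: x - a *: y.
have zz : dot z z = real (n * (n * rnorm x ^+ 2 - rnorm a ^+ 2)).
  rewrite /z dotBl !dotBr !dotZl !dotZr (dot_conj x y) -/a scalar_conj_real.
  rewrite !dot_self -/n (rmorphM real n) rmorphB (rmorphM real n).
  by rewrite -mul_scalar_conj; ring.
have /(fmorph_inj real) zE := etrans (esym (dot_self z)) zz.
rewrite -(ler_pXn2r (_ : 0 < 2)%N)// ?nnegrE ?mulr_ge0 ?rnorm_ge0//.
rewrite exprMn mulrC -/n -subr_ge0 -(pmulr_rge0 _ n0) -zE.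
by rewrite exprn_ge0// rnorm_ge0.
Qed.

(* Multiplying scalars by a fixed nonzero vector x embeds them in the complete
   space X; the limit is recovered as (y | x) / (x | x). *)
Lemma scalar_cauchy_cvg (X_nonzero : exists x : X, x != 0) (u : nat -> K) :
  (forall e : R, 0 < e ->
    exists N, forall n, (N <= n)%N -> rnorm (u N - u n) <= e) ->
  exists l : K, u @ \oo --> l.
Proof.
case: X_nonzero => x x0 cu.
have nx0 : 0 < rnorm x by rewrite lt_neqAle eq_sym rnorm_eq0 x0 rnorm_ge0.
have /rnorm_cauchy_cvg/cvg_ex[y /rnorm_cvgP uy] : forall e : R, 0 < e ->
    exists N, forall n, (N <= n)%N -> rnorm (u N *: x - u n *: x) <= e.
  move=> e e0; have [|N uN] := cu (e / rnorm x); first by rewrite divr_gt0.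
  by exists N => n Nn; rewrite -scalerBl rnormZ -ler_pdivlMr// uN.
exists (dot y x / dot x x); apply/rnorm_cvgKP => e e0.
apply: filterS (uy (e * rnorm x) _) => [n yn|]; last by rewrite mulr_gt0.
have dx0 : dot x x != 0 by rewrite dot_self fmorph_eq0 expf_neq0// gt_eqF.
have -> : dot y x / dot x x - u n = dot (y - u n *: x) x / dot x x.
  by rewrite dotBl dotZl mulrBl mulfK.
rewrite rnormM -(ler_pM2r (exprn_gt0 2 nx0)) -mulrA.
have -> : rnorm (dot x x)^-1 * rnorm x ^+ 2 = 1.
  rewrite -[X in _ * X]ger0_norm ?exprn_ge0 ?rnorm_ge0//.
  rewrite -(@rnorm_real R k) -dot_self -rnormM mulVf//.
  by rewrite -(rmorph1 real) rnorm_real normr1.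
rewrite mulr1; apply: le_trans (cauchy_schwarz _ _) _.
by rewrite expr2 mulrA ler_wpM2r// rnorm_ge0.
Qed.

End dot_product.


(** * Operations on Borel sets *)

Section borel_sets.
Context (T : topologicalType).

Lemma borel_sigma_algebra : sigma_algebra [set: T] (borel T).
Proof. exact: smallest_sigma_algebra. Qed.

Definition Borel (A : set T) (hA : borel T A) : borel T :=
  exist _ A (mem_set hA).

Lemma borelP (A : borel T) : borel T (val A).
Proof. exact/set_mem/valP. Qed.

Lemma borel_open (A : set T) : open A -> borel T A.
Proof. exact: sub_sigma_algebra. Qed.

Lemma borel_set0 : borel T set0.
Proof. by case: borel_sigma_algebra. Qed.

Lemma borel_setC (A : set T) : borel T A -> borel T (~` A).
Proof. by rewrite -setTD; case: borel_sigma_algebra => _ + _; apply. Qed.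

Lemma borel_bigcup (F : (set T)^nat) :
  (forall i, borel T (F i)) -> borel T (\bigcup_i F i).
Proof. by case: borel_sigma_algebra => _ _; apply. Qed.

Lemma borel_setU (A B : set T) : borel T A -> borel T B -> borel T (A `|` B).
Proof.
move=> bA bB; rewrite -bigcup2E; apply: borel_bigcup => -[|[|i]] //=.
exact: borel_set0.
Qed.

Lemma borel_setI (A B : set T) : borel T A -> borel T B -> borel T (A `&` B).
Proof.
move=> bA bB; rewrite -[A `&` B]setCK setCI.
exact: borel_setC (borel_setU (borel_setC bA) (borel_setC bB)).
Qed.

Lemma borel_setD (A B : set T) : borel T A -> borel T B -> borel T (A `\` B).
Proof. by move=> bA bB; rewrite setDE; exact: borel_setI bA (borel_setC bB). Qed.

Definition borel0 : borel T := Borel borel_set0.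
Definition borelI (A B : borel T) : borel T :=
  Borel (borel_setI (borelP A) (borelP B)).
Definition borelD (A B : borel T) : borel T :=
  Borel (borel_setD (borelP A) (borelP B)).

Lemma borel_eq (A B : borel T) : val A = val B -> A = B.
Proof. exact: val_inj. Qed.

End borel_sets.

(** * Consequences of countable additivity for vector measures *)

Section countable_additivity.
Context (R : realType) (k : scalar_kind) (T : metricType R)
  (X : normedModType (scalar_field R k)) (mu : borel T -> X).
Hypothesis mu_ca : countably_additive mu.

(** The partial sums for a sequence of empty sets and their shift have the same limit, while their
    difference is constantly the measure of the empty set. *)
Lemma measure0 : mu (borel0 T) = 0.
Proof.
pose S n := \sum_(0 <= i < n) mu (borel0 T).
have S0 : S @ \oo --> mu (borel0 T).
  apply: (@mu_ca (fun=> borel0 T)); last by rewrite bigcup0.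
  by apply/trivIsetP => i j _ _ _; exact: setI0.
have S1 : (fun n => S n.+1) @ \oo --> mu (borel0 T) by rewrite cvg_shiftS.
have : (fun n => S n.+1) - S @ \oo --> (0 : X).
  by rewrite -(subrr (mu (borel0 T))); exact: cvgB.
have -> : (fun n => S n.+1) - S = fun=> mu (borel0 T).
  by apply/funext => n; rewrite -[LHS]/(S n.+1 - S n) /S big_nat_recr//=
    addrAC subrr add0r.
move=> mu0; apply: (cvg_unique (@norm_hausdorff _ X) _ mu0); exact: cvg_cst.
Qed.

(** Finite additivity follows by padding the two pieces with empty sets. *)
Lemma measure_split (A B : borel T) :
  mu A = mu (borelI A B) + mu (borelD A B).
Proof.
pose F (i : nat) := if i is i'.+1 then if i' is 0 then borelD A B else borel0 T
                   else borelI A B.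
have tF : trivIset [set: nat] (fun i => val (F i)).
  apply/trivIsetP => -[|[|i]] [|[|j]] //= _ _ _; rewrite ?setI0 ?set0I//.
    by rewrite setDE setIACA setICr setI0.
  by rewrite setDE setIACA setICl setI0.
have AF : val A = \bigcup_i val (F i).
  apply/seteqP; split=> [t At|t [[|[|i]] _ []]]//.
  have [Bt|Bt] := pselect (val B t); first by exists 0%N.
  by exists 1%N.
have := mu_ca tF AF; rewrite -(cvg_shiftn 2).
have -> : (fun n => \sum_(0 <= i < n + 2) mu (F i)) =
    (fun=> mu (borelI A B) + mu (borelD A B)).
  apply/funext => n; rewrite addn2 !big_nat_recl// big1 ?addr0//.
  by move=> i _; rewrite measure0.
move=> h; apply: (cvg_unique (@norm_hausdorff _ X) h); exact: cvg_cst.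
Qed.

(** Continuity from below: the successive differences are disjoint and their measures telescope. *)
Lemma measure_nondecreasing_cvg (F : nat -> borel T) (A : borel T) :
  nondecreasing_seq (fun i => val (F i)) -> val A = \bigcup_i val (F i) ->
  mu \o F @ \oo --> mu A.
Proof.
move=> ndF AF.
pose D i := if i is i'.+1 then borelD (F i) (F i') else F 0%N.
have DE : (fun i => val (D i)) = seqD (fun i => val (F i)).
  by apply/funext; case.
have := @mu_ca D A; rewrite DE => /(_ (trivIset_seqD ndF)).
rewrite eq_bigcup_seqD => /(_ AF); rewrite -cvg_shiftS.
suff -> : (fun n => \sum_(0 <= i < n.+1) mu (D i)) = mu \o F by [].
apply/funext; elim=> [|n ih]; first by rewrite big_nat1.
rewrite big_nat_recr//= ih /= (measure_split (F n.+1) (F n)); congr (mu _ + _).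
by apply: borel_eq => /=; rewrite setIidr//; exact/subsetPset/ndF.
Qed.

End countable_additivity.

(** * Integrals of simple functions, bounded by sup-norm times variation *)

Section simple_functions.
Context (R : realType) (k : scalar_kind) (T : metricType R)
  (X : completeNormedModType (scalar_field R k)).
Variable dot : {dot X for scalar_conj R k}.

(* The sets of [s] may overlap; the induction keeps mu additive along the current
   partition so that each new set A only splits every block P i in two. *)
Lemma simple_partition (mu : borel T -> X) (s : seq (borel T * X)) :
    countably_additive mu ->
  exists (I : finType) (P : I -> borel T) (c : I -> X),
  [/\ trivIset [set: I] (fun i => val (P i)),
      \bigcup_i val (P i) = [set: T],
      forall B, mu B = \sum_i mu (borelI B (P i)),
      forall i t, val (P i) t -> simple_fun s t = c i &
      simple_integral dot mu s = \sum_i dot (c i) (mu (P i))].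
Proof.
move=> mu_ca; elim: s => [|[A x] s [I [P [c [tP UP muP sP IP]]]]].
  exists unit, (fun=> borelT T), (fun=> 0); split.
  - by apply/trivIsetP => -[] [].
  - by rewrite bigcup_const//; exists tt.
  - move=> B; rewrite (big_pred1 tt) => [|[]//]; congr mu; apply: borel_eq => /=.
    by rewrite setIT.
  - by move=> i t _; rewrite /simple_fun big_nil.
  - by rewrite /simple_integral big_nil (big_pred1 tt) => [|[]//]; rewrite linear0l.
pose Q (ib : I * bool) := if ib.2 then borelI (P ib.1) A else borelD (P ib.1) A.
exists (I * bool)%type, Q.
exists (fun ib : I * bool => (nat_of_bool ib.2)%:R *: x + c ib.1); split.
- move=> [i b] [j b'] _ _ [t [Qt Q't]].
  have -> : i = j.
    apply: (tP i j) => //; exists t.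
    by split; [case: b Qt => /= -[] | case: b' Q't => /= -[]].
  by case: b b' Qt Q't => -[] //= [_ +] [_].
- apply/seteqP; split=> // t _.
  have : [set: T] t by []; rewrite -UP => -[i _ Pit].
  have [At|At] := pselect (val A t); first by exists (i, true).
  by exists (i, false).
- move=> B; rewrite muP.
  rewrite -(pair_bigA _ (fun i b => mu (borelI B (Q (i, b))))) /=.
  apply: eq_bigr => i _; rewrite big_bool.
  rewrite (measure_split mu_ca _ A); congr (mu _ + mu _).
    by apply: borel_eq => /=; rewrite setIA.
  by apply: borel_eq => /=; rewrite setIDA.
- move=> [i b] t /= Qt; rewrite /simple_fun big_cons; congr (_ + _).
    rewrite indicE; case: b Qt => -[_ At]; first by rewrite mem_set.
    by rewrite memNset.
  by apply: sP; case: b Qt => -[].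
- rewrite /simple_integral big_cons -/(simple_integral dot mu s) IP /=.
  rewrite -(pair_bigA _ (fun i b =>
    dot ((nat_of_bool b)%:R *: x + c i) (mu (Q (i, b))))) /=.
  rewrite muP dot_sumr -big_split /=; apply: eq_bigr => i _.
  rewrite big_bool scale1r scale0r add0r dotDl.
  have -> : mu (borelI A (P i)) = mu (Q (i, true)).
    by congr mu; apply: borel_eq; rewrite /= setIC.
  by rewrite /= -addrA -dotDr -(measure_split mu_ca).
Qed.

Lemma simple_integral_bound (dotH : hilbert_product dot) (mu : cabv T X) :
  exists2 M : R, 0 <= M & forall s C, 0 <= C ->
  (forall t, rnorm (simple_fun s t) <= C) ->
  rnorm (simple_integral dot mu s) <= C * M.
Proof.
case: mu => mu /= /[dup] mu_cabv /asboolP[mu_ca /variation_fin[M mu_bv]].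
exists M => [|s C C0 sC].
  apply: le_trans (mu_bv 1%N (fun=> borelT T) _).
    by rewrite sumr_ge0// => i _; exact: rnorm_ge0.
  split; first by apply/trivIsetP => i j _ _; rewrite !ord1.
  by rewrite bigcup_const//; exists ord0.
have [I [P [c [tP UP _ sP ->]]]] := simple_partition s mu_ca.
apply: le_trans (rnorm_sum _ _ _) _.
apply: le_trans (_ : C * \sum_i rnorm (mu (P i)) <= _); last first.
  rewrite ler_wpM2l//.
  (* The variation ranges over partitions indexed by ordinals, so the blocks are enumerated. *)
  rewrite (reindex (@enum_val I predT)) /=; last exact/onW_bij/enum_val_bij.
  apply: (mu_bv _ (P \o enum_val)); split.
    by move=> i j _ _ /tP; move/(_ Logic.I Logic.I)/enum_val_inj.
  rewrite -UP; apply/seteqP; split=> t [i _ Pit]; first by exists (enum_val i).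
  by exists (enum_rank i); rewrite //= enum_rankK.
rewrite mulr_sumr; apply: ler_sum => i _.
apply: le_trans (cauchy_schwarz dotH _ _) _.
(* The sup-norm bound controls [c i] only on a nonempty block; on an empty one the measure
   vanishes. *)
have [[t Pit]|/set0P/negP/negPn/eqP P0] := pselect (val (P i) !=set0).
  by rewrite ler_wpM2r ?rnorm_ge0// -(sP i t).
have -> : P i = borel0 T by exact: borel_eq.
by rewrite measure0// rnorm0 !mulr0.
Qed.

End simple_functions.


(** * Compactness and uniform approximation of Lipschitz functions by simple ones *)

Lemma compact_net (R : realType) (T : metricType R) (e : R) :
  compact [set: T] -> 0 < e ->
  exists c : seq T, forall t, exists2 x, x \in c & mdist x t < e.
Proof.
move=> cT e0.
have [[t0]|T0] := pselect (inhabited T); last first.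
  by exists [::] => t; case: T0.
pose pT : ptopologicalType :=
  HB.pack_for ptopologicalType T (isPointed.Build T t0).
move: cT; rewrite (@compact_cover pT).
move=> /(_ T [set: T] (fun x => (ball x e)°)) [].
- by move=> x _; exact: open_interior.
- move=> t _; exists t => //; apply: nbhs_singleton.
  by apply: nbhs_interior; exact: nbhsx_ballx.
move=> D _ Tcov; exists (finmap.enum_fset D) => t.
have [x /= xD /interior_subset] := Tcov t Logic.I.
by rewrite ballEmdist; exists x.
Qed.

Lemma compact_diameter (R : realType) (T : metricType R) (t0 : T) :
  compact [set: T] -> exists D : R, forall t, mdist t t0 <= D.
Proof.
move=> /(@compact_net _ T 1) /(_ ltr01)[c cP].
(* Every point is within 1 of some centre; the sum of all the distances to [t0] dominates each of
   them. *)
exists (1 + \sum_(x <- c) mdist x t0) => t; have [x xc xt] := cP t.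
apply: le_trans (metric_triangle _ x _) _; apply: lerD.
  by rewrite metric_sym ltW.
by rewrite (big_rem x)//= lerDl sumr_ge0// => y _; exact: mdist_ge0.
Qed.

(** The ball of radius g(t) - r around t stays in the set. Required for all pairs, the one-sided
    bound is the Lipschitz condition with constant 1. *)
Lemma open_gt_lipschitz (R : realType) (T : metricType R) (g : T -> R) (r : R) :
  (forall s t, g s - g t <= mdist s t) -> open [set t | r < g t].
Proof.
move=> g1; rewrite openE => t /= rt; apply/nbhs_ballP.
exists (g t - r) => [|u]; first by rewrite /= subr_gt0.
by rewrite ballEmdist /= => tu; have := g1 t u; lra.
Qed.

Section lipschitz.
Context (R : realType) (k : scalar_kind) (T : metricType R)
  (X : completeNormedModType (scalar_field R k)).

(** The infimum is itself a Lipschitz constant: for distinct s and t the difference quotient is a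
    lower bound of all Lipschitz constants. *)
Lemma lipschitz_ballP (f : T -> X) : lipschitz_ball f <->
  forall s t, rnorm (f s - f t) <= mdist s t.
Proof.
split=> [[[L0 fL0] fle1] s t|f1]; last first.
  have f1L : lipschitz_const f 1 by split=> // s t; rewrite mul1r.
  split; first by exists 1.
  by apply: ge_inf f1L; exists 0 => L [].
have [->|st] := eqVneq s t.
  by rewrite subrr rnorm0 mdistxx.
have st0 : 0 < mdist s t by rewrite mdist_gt0.
rewrite -[leRHS]mul1r -ler_pdivrMr//; apply: le_trans fle1.
apply: lb_le_inf; first by exists L0.
by move=> L [_ fL]; rewrite ler_pdivrMr.
Qed.

Lemma simple_approx (f : T -> X) (e : R) : compact [set: T] -> 0 < e ->
  lipschitz_ball f ->
  exists s : seq (borel T * X), forall t, rnorm (f t - simple_fun s t) <= e.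
Proof.
move=> cT e0 /lipschitz_ballP f1; have [c cP] := compact_net cT e0.
(* Induction over the centres of the net. Since the sum built so far vanishes outside [U], the part
   of a new ball outside [U] can receive the value of f at its centre. *)
suff [U [s [cU Us _]]] : exists (U : borel T) (s : seq (borel T * X)),
  [/\ forall x t, x \in c -> mdist x t < e -> val U t,
      forall t, val U t -> rnorm (f t - simple_fun s t) <= e &
      forall t, ~ val U t -> simple_fun s t = 0].
  by exists s => t; apply: Us; have [x xc xt] := cP t; exact: cU xt.
elim: {cP} c => [|x c [U [s [cU Us U0]]]].
  by exists (borel0 T), [::]; split=> // t _; rewrite /simple_fun big_nil.
have oB : open [set t | mdist x t < e].
  (* The ball is a superlevel set of the 1-Lipschitz function -d(x, .). *)
  rewrite (_ : [set _ | _] = [set t | - e < - mdist x t]).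
    apply: open_gt_lipschitz => t u; rewrite opprK addrC lerBlDr.
    by rewrite addrC; exact: metric_triangle.
  by apply/seteqP; split => t /=; rewrite ltrN2.
pose B := Borel (borel_open oB).
exists (Borel (borel_setU (borelP B) (borelP U))), ((borelD B U, f x) :: s).
split.
- move=> y t; rewrite inE => /orP[/eqP->|yc] yt; first by left.
  by right; exact: cU yt.
- move=> t [/= xt|Ut]; rewrite /simple_fun big_cons/= -/(simple_fun s t).
    have [Ut|nUt] := pselect (val U t).
      by rewrite indicE memNset ?scale0r ?add0r; [exact: Us|case].
    rewrite indicE mem_set// scale1r U0// addr0.
    by apply: le_trans (f1 _ _) _; rewrite metric_sym ltW.
  by rewrite indicE memNset ?scale0r ?add0r; [exact: Us|case].
- move=> t nBU; rewrite /simple_fun big_cons/= -/(simple_fun s t).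
  rewrite indicE memNset ?scale0r ?add0r; last by case=> Bt; case: nBU; left.
  by apply: U0 => Ut; apply: nBU; right.
Qed.

Lemma simple_approx_uniform (f : T -> X) : compact [set: T] ->
  lipschitz_ball f ->
  exists s : nat -> seq (borel T * X),
    {uniform, (fun n => simple_fun (s n)) @ \oo --> f}.
Proof.
move=> cT f1.
have /choice[s sP] : forall n : nat, exists s : seq (borel T * X),
    forall t, rnorm (f t - simple_fun s t) <= n.+1%:R^-1.
  by move=> n; apply: simple_approx => //; rewrite invr_gt0.
exists s; apply/uniform_rnormP => e e0.
near=> n => t; apply: le_trans (sP n t) _.
near: n; apply: filterS (near_infty_natSinv_lt (PosNum e0)) => n; exact: ltW.
Unshelve. all: by end_near. Qed.

End lipschitz.

(** * Existence of the integral, its dependence on the measure, and a uniform bound *)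

(* [integral] alone is the Lebesgue integral of MathComp-Analysis, hence the
   qualified name [Defs.integral]. *)
Section integral_theory.
Context (R : realType) (k : scalar_kind) (T : metricType R)
  (X : completeNormedModType (scalar_field R k)).
Variable dot : {dot X for scalar_conj R k}.
Hypothesis dotH : hilbert_product dot.
Hypothesis X_nonzero : exists x : X, x != 0.
Hypothesis T_compact : compact [set: T].
Implicit Types (mu nu : cabv T X) (s : seq (borel T * X)).

(** Concatenating the lists suffices because the sets of a simple function may overlap. *)
Lemma simple_sub s1 s2 : exists s,
  (forall t, simple_fun s t = simple_fun s1 t - simple_fun s2 t) /\
  (forall mu : borel T -> X, simple_integral dot mu s =
    simple_integral dot mu s1 - simple_integral dot mu s2).
Proof.
exists (s1 ++ [seq (q.1, - q.2) | q <- s2]); split=> [t|mu].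
  rewrite /simple_fun big_cat big_map/= -sumrN; congr (_ + _).
  by apply: eq_bigr => q _; rewrite scalerN.
rewrite /simple_integral big_cat big_map/= -sumrN; congr (_ + _).
by apply: eq_bigr => q _; rewrite linearNl.
Qed.

Lemma simple_integral_dist mu : exists2 M : R, 0 < M &
  forall s1 s2 C, 0 <= C ->
  (forall t, rnorm (simple_fun s1 t - simple_fun s2 t) <= C) ->
  rnorm (simple_integral dot mu s1 - simple_integral dot mu s2) <= C * M.
Proof.
have [M M0 muM] := simple_integral_bound dotH mu.
(* Adding 1 makes the constant positive, so that later tolerances can be divided by it. *)
exists (M + 1) => [|s1 s2 C C0 sC]; first by rewrite ltr_pwDr.
have [s [sE <-]] := simple_sub s1 s2.
apply: le_trans (muM s C C0 _) _ => [t|]; first by rewrite sE.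
by rewrite ler_wpM2l// lerDl.
Qed.

Lemma is_integral_cvg mu (f : T -> X) l (s : nat -> seq (borel T * X)) :
  is_integral dot mu f l ->
  {uniform, (fun n => simple_fun (s n)) @ \oo --> f} ->
  (fun n => simple_integral dot mu (s n)) @ \oo --> l.
Proof.
move=> [r [/uniform_rnormP rf /rnorm_cvgKP rl]] /uniform_rnormP sf.
have [M M0 muM] := simple_integral_dist mu.
apply/rnorm_cvgKP => e e0.
(* The two uniform errors e/4/M cost e/2 after multiplication by M; convergence along [r] costs the
   other e/2. *)
have eM : 0 < e / 4 / M by rewrite !divr_gt0.
have e2 : 0 < e / 2 by rewrite divr_gt0.
near=> n.
have rn : forall t, rnorm (f t - simple_fun (r n) t) <= e / 4 / M.
  by near: n; exact: rf.
have sn : forall t, rnorm (f t - simple_fun (s n) t) <= e / 4 / M.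
  by near: n; exact: sf.
have : rnorm (simple_integral dot mu (r n) - simple_integral dot mu (s n))
    <= (e / 4 / M + e / 4 / M) * M.
  apply: muM => [|t]; first by rewrite addr_ge0// ltW.
  apply: le_trans (rnorm_distD (f t) _ _) _; rewrite [X in X + _]rnormBC.
  exact: lerD.
rewrite mulrDl divfK ?gt_eqF// => rs.
apply: le_trans (rnorm_distD (simple_integral dot mu (r n)) _ _) _.
have : rnorm (l - simple_integral dot mu (r n)) <= e / 2 by near: n; exact: rl.
by move: rs; lra.
Unshelve. all: by end_near. Qed.

(** The simple integrals form a Cauchy sequence, so an integral exists and [xget] does not fall back
    on its default 0. *)
Lemma integral_cvg mu (f : T -> X) (s : nat -> seq (borel T * X)) :
  {uniform, (fun n => simple_fun (s n)) @ \oo --> f} ->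
  (fun n => simple_integral dot mu (s n)) @ \oo --> Defs.integral dot mu f.
Proof.
move=> sf; apply: is_integral_cvg (sf).
suff : exists l, is_integral dot mu f l by exact: xgetPex.
have [M M0 muM] := simple_integral_dist mu.
suff [l sl] : exists l : scalar_field R k,
  (fun n => simple_integral dot mu (s n)) @ \oo --> l by exists l, s.
apply: (scalar_cauchy_cvg dotH X_nonzero) => e e0.
have eM : 0 < e / 2 / M by rewrite !divr_gt0.
have /uniform_rnormP/(_ _ eM)[N _ sN] := sf.
exists N => n Nn.
apply: le_trans (_ : (e / 2 / M + e / 2 / M) * M <= _); last first.
  by rewrite mulrDl divfK ?gt_eqF// -splitr.
apply: muM => [|t]; first by rewrite addr_ge0// ltW.
apply: le_trans (rnorm_distD (f t) _ _) _; rewrite [X in X + _]rnormBC.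
apply: lerD; [exact: (sN N (leqnn N)) | exact: (sN n Nn)].
Qed.

(** A single approximating sequence of f serves all three measures. *)
Lemma integral_measureD mu nu (f : T -> X) : lipschitz_ball f ->
  Defs.integral dot (mu + nu) f =
  Defs.integral dot mu f + Defs.integral dot nu f.
Proof.
move=> /(simple_approx_uniform T_compact)[s sf].
apply: (scalar_cvg_unique (integral_cvg (mu := mu + nu) sf)).
suff -> : (fun n => simple_integral dot (mu + nu) (s n)) =
    (fun n => simple_integral dot mu (s n) + simple_integral dot nu (s n)).
  by apply: cvgD; exact: integral_cvg.
apply/funext => n; rewrite -big_split; apply: eq_bigr => q _.
exact: dotDr.
Qed.

Lemma integral_measureZ a mu (f : T -> X) : lipschitz_ball f ->
  Defs.integral dot (a *: mu) f = scalar_conj R k a * Defs.integral dot mu f.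
Proof.
move=> /(simple_approx_uniform T_compact)[s sf].
apply: (scalar_cvg_unique (integral_cvg (mu := a *: mu) sf)).
suff -> : (fun n => simple_integral dot (a *: mu) (s n)) =
    (fun n => scalar_conj R k a * simple_integral dot mu (s n)).
  by apply: cvgMl_tmp; exact: integral_cvg.
apply/funext => n; rewrite mulr_sumr; apply: eq_bigr => q _.
exact: dotZr.
Qed.

Lemma integral_lipschitz_bound (t0 : T) (mu : cabv0 T X) :
  exists C : R, forall f : T -> X, lipschitz_ball f ->
    rnorm (Defs.integral dot mu f) <= C.
Proof.
have [D Dt0] := compact_diameter t0 T_compact.
have D0 : 0 <= D by rewrite (le_trans _ (Dt0 t0))// mdist_ge0.
have [M M0 muM] := simple_integral_dist mu.
(* The first 1 bounds the error of the simple integral; 1 + D bounds the distance of the simple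
   function to the constant f(t0). *)
exists (1 + (1 + D) * M) => f f1.
have [s sf] := simple_approx_uniform T_compact f1.
have /rnorm_cvgKP/(_ _ ltr01) sl := integral_cvg (mu := mu) sf.
move/uniform_rnormP : sf => /(_ _ ltr01) sf.
have [n [sn ln]] := filter_ex (filterI sf sl).
(* The constant f(t0) integrates to (f(t0) | mu(T)) = 0, so it can be subtracted. *)
have muT : simple_integral dot mu [:: (borelT T, f t0)] = 0.
  rewrite /simple_integral big_seq1 /=.
  by case: mu {muM sl ln} => nu /= /eqP ->; rewrite linear0r.
rewrite -[Defs.integral _ _ _](subrK (simple_integral dot mu (s n))).
apply: le_trans (rnormD _ _) _; apply: lerD.
  exact: ln.
rewrite -[simple_integral _ _ _]subr0 -muT; apply: muM => [|t].
  by rewrite addr_ge0.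
rewrite {2}/simple_fun big_seq1 /= indicE mem_set// scale1r.
apply: le_trans (rnorm_distD (f t) _ _) _; rewrite [X in X + _]rnormBC.
apply: lerD => //.
by apply: le_trans (Dt0 t); move/lipschitz_ballP : f1; exact.
Qed.

End integral_theory.


(** * The distance to a nonempty set *)

Section distance_to_set.
Context (R : realType) (T : metricType R).
Variable F : set T.
Hypothesis F0 : F !=set0.

Definition dist_to (t : T) : R := inf [set mdist t u | u in F].

Lemma dist_to_le t u : F u -> dist_to t <= mdist t u.
Proof.
move=> Fu; apply: ge_inf; last by exists u.
by exists 0 => _ [v _ <-]; exact: mdist_ge0.
Qed.

Lemma le_dist_to t r : (forall u, F u -> r <= mdist t u) -> r <= dist_to t.
Proof.
move=> rF; apply: lb_le_inf; last by move=> _ [v Fv <-]; exact: rF.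
by case: F0 => u Fu; exists (mdist t u), u.
Qed.

Lemma dist_to_ge0 t : 0 <= dist_to t.
Proof. by apply: le_dist_to => u _; exact: mdist_ge0. Qed.

Lemma dist_to_lipschitz s t : dist_to s - dist_to t <= mdist s t.
Proof.
rewrite lerBlDr -lerBlDl; apply: le_dist_to => u Fu.
rewrite lerBlDl; apply: le_trans (metric_triangle s t u).
exact: dist_to_le.
Qed.

Lemma dist_to_gt0 t : closed F -> (0 < dist_to t) <-> (~` F) t.
Proof.
move=> cF; split=> [+ Ft|nFt].
  by rewrite ltNge; apply/negP; rewrite negbK -(mdistxx t) dist_to_le.
have : open (~` F) by rewrite openC.
rewrite openE => /(_ t nFt)/nbhs_ballP[e /= e0 eF].
apply: lt_le_trans e0 _; apply: le_dist_to => u Fu.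
by rewrite leNgt; apply/negP => tu; apply: (eF u) => //; rewrite ballEmdist.
Qed.

End distance_to_set.

(** Counting the levels j e below y overshoots min(N e, y) by at most one step. The induction proves
    the sharper upper bound min(N e, y + e). *)
Lemma level_sum (R : realType) (e y : R) (N : nat) : 0 <= e -> 0 <= y ->
  `|Num.min (N%:R * e) y - e * \sum_(j < N) (j%:R * e < y)%R%:R| <= e.
Proof.
move=> e0 y0.
suff /andP[S1 S2] : Num.min (N%:R * e) y <= e * \sum_(j < N) (j%:R * e < y)%R%:R
    <= Num.min (N%:R * e) (y + e).
  rewrite distrC ger0_norm ?subr_ge0// lerBlDr; apply: le_trans S2 _.
  rewrite /Num.min; do 2 case: ifPn => //; rewrite -?leNgt; lra.
elim: N => [|N ih].
  by rewrite big_ord0 mulr0 mul0r ge_min le_min lexx addr_ge0.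
rewrite big_ord_recr/= mulrDr -natr1 mulrDl mul1r.
move: ih; rewrite !ge_min !le_min; set S := e * \sum_(j < N) _; set a := _ * e.
have [ay|ya] := ltP a y; rewrite ?mulr1 ?mulr0.
  by move=> /andP[/orP[] ? /andP[? ?]]; apply/and3P; split; lra.
by move=> /andP[/orP[] ? /andP[? ?]]; apply/and3P; split; lra.
Qed.

(** * Definiteness: a measure that annihilates the Lipschitz ball vanishes on open sets *)

Section definiteness.
Context (R : realType) (k : scalar_kind) (T : metricType R)
  (X : completeNormedModType (scalar_field R k)).
Variable dot : {dot X for scalar_conj R k}.
Hypothesis dotH : hilbert_product dot.
Hypothesis X_nonzero : exists x : X, x != 0.
Local Notation real := (scalar_real R k).

Section superlevel.
Variable g : T -> R.
Hypothesis g1 : forall s t, g s - g t <= mdist s t.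

Definition superlevel (r : R) : borel T :=
  Borel (borel_open (open_gt_lipschitz r g1)).

(** Otherwise there are bad levels decreasing to 0; their superlevel sets increase to {g > 0},
    against continuity from below. *)
Lemma superlevel_right_continuous (mu : borel T -> X) (e : R) :
    countably_additive mu -> 0 < e ->
  exists2 d : R, 0 < d & forall r, 0 <= r <= d ->
    rnorm (mu (superlevel 0) - mu (superlevel r)) <= e.
Proof.
move=> mu_ca e0; apply: contrapT => nd.
have /choice[c cP] : forall d : R, exists r, 0 < d ->
    0 < r <= d /\ e < rnorm (mu (superlevel 0) - mu (superlevel r)).
  move=> d; apply: contrapT => /forallNP dP; apply: nd; exists d => [|r].
    by apply: contrapT => d0; apply: (dP 0) => /d0.
  move=> /andP[]; rewrite le_eqVlt => /predU1P[<- _|r0 rd].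
    by rewrite subrr rnorm0 ltW.
  by rewrite leNgt; apply/negP => er; apply: (dP r) => _; rewrite r0 rd.
(* Each bad level is chosen below its predecessor and below 1/(n+1), so the sequence decreases to
   0. *)
pose r := fix r n := c (if n is m.+1 then Num.min (r m) n.+1%:R^-1 else 1).
have r0 n : 0 < r n.
  elim: n => [|n ih] /=; first by case: (cP 1) => // /andP[].
  have [|/andP[]//] := cP (Num.min (r n) n.+2%:R^-1).
  by rewrite lt_min ih invr_gt0 ltr0n.
have min0 n : 0 < Num.min (r n) n.+2%:R^-1.
  by rewrite lt_min r0 invr_gt0 ltr0n.
have rS n : r n.+1 <= r n.
  by have [/andP[_ +] _] := cP _ (min0 n); rewrite le_min => /andP[].
have rinv n : r n.+1 <= n.+2%:R^-1.
  by have [/andP[_ +] _] := cP _ (min0 n); rewrite le_min => /andP[].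
have rbad n : e < rnorm (mu (superlevel 0) - mu (superlevel (r n))).
  case: n => [|n]; first by case: (cP 1).
  by have [_] := cP _ (min0 n).
have := @measure_nondecreasing_cvg _ _ _ _ _ mu_ca
  (superlevel \o r) (superlevel 0).
have nd_r : nondecreasing_seq (fun i => val ((superlevel \o r) i)).
  apply/nondecreasing_seqP => n; apply/subsetPset => t /=.
  exact: le_lt_trans (rS n).
have U_r : val (superlevel 0) = \bigcup_i val ((superlevel \o r) i).
  apply/seteqP; split=> t /=; last by case=> i _ /=; apply: lt_trans.
  move=> gt0; have [N _ /(_ N.+1)] := near_infty_natSinv_lt (PosNum gt0).
  move=> /(_ (leqnSn N)) /= Ng; exists N.+1 => //=.
  by apply: le_lt_trans Ng; exact: rinv.
move=> /(_ nd_r U_r)/rnorm_cvgP/(_ _ e0)[N _ /(_ N)].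
by move=> /(_ (leqnn N)) /=; rewrite leNgt rbad.
Qed.

(* Layer-cake approximation: the value of min(d, g) is, up to one step d/(n+1),
   the step times the number of levels j d/(n+1), j <= n, below g. *)
Definition layers (d : R) (y : X) (n : nat) : seq (borel T * X) :=
  [seq (superlevel (j%:R * (d / n.+1%:R)), real (d / n.+1%:R) *: y)
    | j <- iota 0 n.+1].

Lemma layers_uniform (d : R) (y : X) : 0 <= d -> (forall t, 0 <= g t) ->
  rnorm y <= 1 ->
  {uniform, (fun n => simple_fun (layers d y n)) @ \oo -->
    (fun t => real (Num.min d (g t)) *: y)}.
Proof.
move=> d0 g0 y1; apply/uniform_rnormP => e e0.
(* For 1/(n+1) below e/(d+1) the step d/(n+1) is at most e; the denominator d + 1 also covers d =
   0. *)
have d1e : 0 < e / (d + 1) by rewrite divr_gt0// ltr_pwDr.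
have := near_infty_natSinv_lt (PosNum d1e).
apply: filterS => n /= ne t; set c := d / n.+1%:R.
have c0 : 0 <= c by rewrite divr_ge0.
have -> : simple_fun (layers d y n) t =
    real (c * \sum_(j < n.+1) (j%:R * c < g t)%R%:R) *: y.
  rewrite /simple_fun /layers big_map -/c.
  rewrite mulr_sumr rmorph_sum scaler_suml -(big_mkord xpredT (fun j =>
    real (c * (j%:R * c < g t)%R%:R) *: y)) /index_iota subn0.
  apply: eq_bigr => j _ /=; rewrite scalerA; congr (_ *: _).
  rewrite indicE rmorphM mulrC rmorph_nat; congr (_ * _%:R).
  congr nat_of_bool; apply/idP/idP => [/set_mem//|].
  by move=> ?; apply/mem_set.
have -> : d = n.+1%:R * c by rewrite mulrC divfK// pnatr_eq0.
rewrite -scalerBl rnormZ -rmorphB rnorm_real -[leRHS]mulr1.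
apply: ler_pM => //; rewrite ?rnorm_ge0//.
apply: le_trans (level_sum _ _ _) _ => //.
apply: le_trans (_ : d * (e / (d + 1)) <= _); first by rewrite ler_wpM2l// ltW.
rewrite mulrCA; apply: ler_piMr; first exact: ltW.
by rewrite ler_pdivrMr ?ltr_pwDr// mul1r lerDl.
Qed.

Lemma simple_integral_layers (mu : borel T -> X) (d : R) (y : X) (n : nat) :
  simple_integral dot mu (layers d y n) =
  \sum_(j < n.+1) real (d / n.+1%:R) *
    dot y (mu (superlevel (j%:R * (d / n.+1%:R)))).
Proof.
rewrite /simple_integral /layers big_map -(big_mkord xpredT (fun j =>
  real (d / n.+1%:R) * dot y (mu (superlevel (j%:R * (d / n.+1%:R)))))).
rewrite /index_iota subn0.
by apply: eq_bigr => j _ /=; rewrite dotZl.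
Qed.

Lemma measure_superlevel0 (mu : cabv T X) : (forall t, 0 <= g t) ->
  (forall f : T -> X, lipschitz_ball f -> Defs.integral dot mu f = 0) ->
  mu (superlevel 0) = 0.
Proof.
move=> g0 mu0; set x := mu (superlevel 0).
(* Scaling x to norm at most 1 keeps min(d, g) y in the Lipschitz ball; adding 1 avoids dividing by
   zero when x = 0. *)
pose y := real ((1 + rnorm x)^-1) *: x.
have x1 : 0 < 1 + rnorm x by rewrite ltr_pwDl// rnorm_ge0.
have y1 : rnorm y <= 1.
  rewrite rnormZ rnorm_real gtr0_norm ?invr_gt0//.
  by rewrite mulrC ler_pdivrMr// mul1r lerDr.
suff yx : dot y x = 0.
  apply/eqP; rewrite -rnorm_eq0 -(sqrf_eq0 (rnorm x)).
  move: yx => /eqP; rewrite /y dotZl dot_self// mulf_eq0 !fmorph_eq0.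
  by rewrite invr_eq0 gt_eqF.
apply/eqP; rewrite -rnorm_eq0 eq_le rnorm_ge0 andbT.
apply/ler_addgt0Pl => e e0; rewrite addr0.
have mu_ca : countably_additive mu by case: (mu) => m /= /asboolP[].
have e2 : 0 < e / 2 by rewrite divr_gt0.
have [d d0 dP] := superlevel_right_continuous mu_ca e2.
pose f t := real (Num.min d (g t)) *: y.
have f1 : lipschitz_ball f.
  apply/lipschitz_ballP => s t; rewrite /f -scalerBl rnormZ -rmorphB rnorm_real.
  apply: le_trans (_ : `|Num.min d (g s) - Num.min d (g t)| <= _).
    by rewrite ler_piMr.
  have := g1 s t; have := g1 t s; rewrite metric_sym ler_norml.
  rewrite /Num.min; do 2 case: ifPn; rewrite -?leNgt; lra.
have := integral_cvg dotH X_nonzero (mu := mu) (layers_uniform (ltW d0) g0 y1).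
(* The layered sums tend to the integral of f, which is 0. The tolerance carries a factor d because
   d (y | x) is what gets estimated. *)
rewrite -/f mu0// => /rnorm_cvgKP/(_ (d * (e / 2))).
rewrite mulr_gt0// => /(_ isT)[N _ /(_ N (leqnn N))] /=.
rewrite sub0r rnormN simple_integral_layers; set c := d / N.+1%:R => sN.
have c0 : 0 <= c by rewrite divr_ge0// ltW.
have dE : d = N.+1%:R * c by rewrite mulrC divfK// pnatr_eq0.
(* Cut into N+1 equal terms, d (y | x) can be compared with the layered sum level by level. *)
have dx : real d * dot y x = \sum_(j < N.+1) real c * dot y x.
  by rewrite sumr_const card_ord -mulrnAl -rmorphMn/= -mulr_natl -dE.
rewrite -(ler_pM2l d0) -[X in X * _](ger0_norm (ltW d0)) -(@rnorm_real R k).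
rewrite -rnormM dx -[X in rnorm X](subrK (\sum_(j < N.+1) real c *
  dot y (mu (superlevel (j%:R * c))))).
apply: le_trans (rnormD _ _) _.
rewrite [leRHS](_ : _ = d * (e / 2) + d * (e / 2)); last first.
  by rewrite -mulrDr -splitr.
apply: lerD => //.
rewrite -sumrB; apply: le_trans (rnorm_sum _ _ _) _.
rewrite [leRHS](_ : _ = \sum_(j < N.+1) c * (e / 2)); last first.
  by rewrite sumr_const card_ord -mulrnAl -[c *+ _]mulr_natl -dE.
(* As j <= N, the level j c lies in [0, d], where [dP] applies. *)
apply: ler_sum => j _; rewrite -mulrBr rnormM rnorm_real ger0_norm//.
rewrite ler_wpM2l// -dotBr; apply: le_trans (cauchy_schwarz dotH _ _) _.
rewrite -[leRHS]mul1r ler_pM ?rnorm_ge0//; apply: dP.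
by rewrite mulr_ge0//= dE ler_wpM2r// ler_nat ltnW.
Qed.

End superlevel.

Lemma measure_open0 (mu : cabv0 T X) (A : borel T) :
  (forall f : T -> X, lipschitz_ball f -> Defs.integral dot mu f = 0) ->
  open (val A) -> mu A = 0.
Proof.
move=> mu0 oA.
(* The distance argument needs a nonempty complement; if it is empty, then A = T and mu(T) = 0. *)
have [F0|/set0P/negP/negPn/eqP F0] := pselect (~` val A !=set0); last first.
  have -> : A = borelT T by apply: borel_eq; rewrite -[LHS]setCK F0 setC0.
  by case: mu {mu0} => nu /= /eqP.
have cF : closed (~` val A) by rewrite closedC.
have -> : A = superlevel (dist_to_lipschitz F0) 0.
  apply: borel_eq; apply/seteqP; split=> t /=.
    by move=> At; apply/(dist_to_gt0 F0 _ cF); rewrite setCK.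
  by move/(dist_to_gt0 F0 _ cF); rewrite setCK.
by apply: measure_superlevel0 => // t; exact: dist_to_ge0.
Qed.

End definiteness.

(** The null Borel sets form a Dynkin system, complements being covered because T is open and hence
    null. Open sets are stable under intersection, so this system contains the generated
    sigma-algebra. *)
Lemma measure_eq0_open (R : realType) (k : scalar_kind) (T : metricType R)
    (X : normedModType (scalar_field R k)) (mu : borel T -> X) :
  countably_additive mu -> (forall A, open (val A) -> mu A = 0) ->
  forall A, mu A = 0.
Proof.
move=> mu_ca mu_open A.
pose P := [set B : set T | exists2 A : borel T, val A = B & mu A = 0].
suff : P (val A) by case=> B /borel_eq ->.
have muT : mu (borelT T) = 0 by apply: mu_open; exact: openT.
have dP : dynkin P.
  split=> [|_ [B <- muB]|F tF FP]; first by exists (borelT T).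
    exists (borelD (borelT T) B); first by rewrite /= setTD.
    move: muT; rewrite (measure_split mu_ca _ B).
    have -> : borelI (borelT T) B = B by apply: borel_eq; rewrite /= setTI.
    by rewrite muB add0r.
  have /choice[G GP] : forall n, exists B : borel T, val B = F n /\ mu B = 0.
    by move=> n; have [B vB muB] := FP n; exists B.
  have GF : F = fun n => val (G n) by apply/funext => n; case: (GP n).
  have bF : borel T (\bigcup_n F n).
    by apply: borel_bigcup => n; rewrite GF; exact: borelP.
  exists (Borel bF) => //.
  have := mu_ca G (Borel bF); rewrite -GF => /(_ tF erefl).
  have -> : (fun n => \sum_(0 <= i < n) mu (G i)) = fun=> 0.
    by apply/funext => n; rewrite big1// => i _; case: (GP i).
  by move=> h; apply: (cvg_unique (@norm_hausdorff _ X) h); exact: cvg_cst.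
have : <<d @open T >> `<=` P.
  by apply: smallest_sub => // B oB; exists (Borel (borel_open oB)) => //;
    exact: mu_open.
apply; rewrite setI_closed_g_dynkin_g_sigma_algebra; first exact: borelP.
by move=> B C; exact: openI.
Qed.

(** * The norm axioms *)

Section MKnorm.
Context (R : realType) (k : scalar_kind) (T : metricType R)
  (X : completeNormedModType (scalar_field R k)).
Variable dot : {dot X for scalar_conj R k}.
Hypothesis dotH : hilbert_product dot.
Hypothesis X_nonzero : exists x : X, x != 0.
Hypothesis T_compact : compact [set: T].
Variable t0 : T.
Implicit Types mu nu : cabv0 T X.

Lemma lipschitz_ball0 : lipschitz_ball (fun _ : T => 0 : X).
Proof.
by apply/lipschitz_ballP => s t; rewrite subrr rnorm0 mdist_ge0.
Qed.

Lemma MKnorm_fin_num mu : MKnorm dot mu \is a fin_num.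
Proof.
have [C muC] := integral_lipschitz_bound dotH X_nonzero T_compact t0 mu.
rewrite fin_real//; apply/andP; split.
  apply: lt_le_trans (ltNyr (rnorm (Defs.integral dot mu (fun=> 0)))) _.
  by apply: ereal_sup_ubound; exists (fun=> 0) => //; exact: lipschitz_ball0.
apply: le_lt_trans (ltry C); apply: ge_ereal_sup => _ [f f1 <-].
by rewrite lee_fin muC.
Qed.

Lemma le_MKnorm mu (f : T -> X) : lipschitz_ball f ->
  rnorm (Defs.integral dot mu f) <= fine (MKnorm dot mu).
Proof.
move=> f1; rewrite -lee_fin fineK ?MKnorm_fin_num//.
by apply: ereal_sup_ubound; exists f.
Qed.

Lemma MKnorm_le mu (C : R) :
  (forall f : T -> X, lipschitz_ball f ->
    rnorm (Defs.integral dot mu f) <= C) ->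
  fine (MKnorm dot mu) <= C.
Proof.
move=> muC; rewrite -lee_fin fineK ?MKnorm_fin_num//.
by apply: ge_ereal_sup => _ [f f1 <-]; rewrite lee_fin muC.
Qed.

Lemma MKnorm_ge0 mu : 0 <= fine (MKnorm dot mu).
Proof. exact: le_trans (rnorm_ge0 _) (le_MKnorm mu lipschitz_ball0). Qed.

(** Half of homogeneity; the reverse inequality follows by applying it to the inverse scalar. *)
Lemma MKnormZ_le a mu :
  fine (MKnorm dot (a *: mu)) <= rnorm a * fine (MKnorm dot mu).
Proof.
apply: MKnorm_le => f f1.
rewrite (integral_measureZ dotH X_nonzero T_compact a mu f1) rnormM rnorm_conj.
by rewrite ler_wpM2l ?rnorm_ge0// le_MKnorm.
Qed.

Lemma MKnorm_eq0 mu : fine (MKnorm dot mu) = 0 -> mu = 0.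
Proof.
move=> mu0; apply/val_inj/val_inj/funext => A.
apply: (@measure_eq0_open _ _ _ _ mu) => [|B oB].
  by case: (cabv0_cabv mu) => nu /= /asboolP[].
apply: (measure_open0 dotH X_nonzero) => // f f1.
by apply/eqP; rewrite -rnorm_eq0 eq_le rnorm_ge0 andbT -mu0 le_MKnorm.
Qed.

End MKnorm.

Theorem theorem16 (R : realType) (k : scalar_kind) (T : metricType R)
    (X : completeNormedModType (scalar_field R k))
    (dot : {dot X for scalar_conj R k})
    (T_compact : compact [set: T])
    (T_two : exists s t : T, s != t)
    (X_hilbert : hilbert_product dot)
    (X_nonzero : exists x : X, x != 0) :
  (forall mu : cabv0 T X, MKnorm dot mu \is a fin_num) /\
  is_norm (fun mu : cabv0 T X => fine (MKnorm dot mu)).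
Proof.
have [t0 _] := T_two.
split=> [mu|]; first exact: MKnorm_fin_num.
have MKZ := MKnormZ_le X_hilbert X_nonzero T_compact t0.
have MK0 : fine (MKnorm dot (0 : cabv0 T X)) = 0.
  apply/eqP; rewrite eq_le MKnorm_ge0// andbT.
  (* The scaling inequality with factor 0 gives the value at the zero measure. *)
  by have := MKZ 0 0; rewrite scale0r rnorm0 mul0r.
split=> [mu|mu|a mu|mu nu].
- exact: MKnorm_ge0.
- by split=> [|->//]; exact: MKnorm_eq0.
- apply/eqP; rewrite eq_le MKZ/=.
  have [->|a0] := eqVneq a 0; first by rewrite scale0r MK0 rnorm0 mul0r.
  (* Scaling back by the inverse of a yields the reverse inequality. *)
  have := MKZ a^-1 (a *: mu); rewrite scalerA mulVf// scale1r => muZ.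
  have na0 : 0 <= rnorm a by exact: rnorm_ge0.
  apply: le_trans (ler_wpM2l na0 muZ) _; rewrite mulrA -rnormM divff//.
  by rewrite -(rmorph1 (scalar_real R k)) rnorm_real normr1 mul1r.
- apply: MKnorm_le => // f f1.
  rewrite (integral_measureD X_hilbert X_nonzero T_compact mu nu f1).
  by apply: le_trans (rnormD _ _) _; apply: lerD; exact: le_MKnorm.
Qed.
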